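(* Let $G$ be a group, let $\mathcal{H}$ be a Hilbert space, and let $U: G\to \mathcal{B}(\mathcal{H})$, $g\mapsto U_g$, be a unitary projective representation of $G$. Let $\mathcal{C}$ be a quantum channel on $\mathcal{H}$ that is covariant, i.e. $\mathcal{C}\circ\mathcal{U}_g=\mathcal{U}_g\circ\mathcal{C}$ for all $g\in G$, where $\mathcal{U}_g(\rho):=U_g\rho U_g^\dagger$. Suppose that $\mathcal{C}$ has a pure fixed point, i.e. there is a unit vector $|\varphi\rangle\in\mathcal{H}$ with $\mathcal{C}(|\varphi\rangle\langle\varphi|)=|\varphi\rangle\langle\varphi|$. For each connected component $\Gamma_k$ of the confusability graph $\Gamma(G,\mathcal{H},U,|\varphi\rangle)$, with vertex set $G_k\subseteq G$, let $S_k$ be the closed linear span of $\{U_g|\varphi\rangle \mid g\in G_k\}$. Then each subspace $S_k$ is decoherence free for $\mathcal{C}$.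
   Context: A unitary projective representation of $G$ is a map $g\mapsto U_g$ into unitary operators on $\mathcal{H}$ such that for all $g,h\in G$ there is a unit-modulus scalar $\omega(g,h)$ with $U_gU_h=\omega(g,h)U_{gh}$. Put $|\varphi_g\rangle:=U_g|\varphi\rangle$. The confusability graph $\Gamma(G,\mathcal{H},U,|\varphi\rangle)$ is the graph with vertex set $G$ in which $g,h\in G$ are joined by an edge whenever $\langle\varphi_g|\varphi_h\rangle\neq 0$; its connected components are the usual ones (vertices joined by finite paths). A quantum channel on $\mathcal{H}$ is a completely positive, trace-preserving, normal linear map $\mathcal{C}$ from trace-class operators on $\mathcal{H}$ to trace-class operators on $\mathcal{H}$ (normality, i.e. weak-* continuity of the dual map on $\mathcal{B}(\mathcal{H})$, is automatic for bounded maps on the trace class). A closed subspace $S\subseteq\mathcal{H}$ is decoherence free for $\mathcal{C}$ if $\mathcal{C}$ preserves every state with support in $S$: $\mathcal{C}(\rho)=\rho$ for every density operator $\rho$ on $\mathcal{H}$ (positive, trace one) with $P\rho P=\rho$, where $P$ is the orthogonal projector onto $S$. *)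

(* Defs.v *)
From HB Require Import structures.
From mathcomp Require Import all_boot all_order all_algebra.
From mathcomp Require Import sesquilinear complex.
From mathcomp Require Import all_classical all_reals all_analysis.
From mathcomp.analysis.showcase Require Import summability.

Set Implicit Arguments.
Unset Strict Implicit.
Unset Printing Implicit Defensive.

Import Order.TTheory GRing.Theory Num.Theory.
Import numFieldNormedType.Exports.

Local Open Scope classical_set_scope.
Local Open Scope ring_scope.

(* Complex Hilbert spaces, of arbitrary dimension: Banach spaces over R[i]
   whose norm comes from an inner product. *)
HB.mixin Record isHilbert (R : realType) H
    & CompleteNormedModule R[i] H := {
  inner : {dot H for @Num.conj R[i]};
  inner_norm : forall x : H, `|x| ^+ 2 = inner x x
}.

#[short(type="hilbertType")]
HB.structure Definition Hilbert (R : realType) :=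
  {H of isHilbert R H & CompleteNormedModule R[i] H}.

Section HilbertSpace.
Context {R : realType} {H : hilbertType R}.
Implicit Types (x y z : H) (T A B : H -> H) (S E : set H).

(* <x|y>, linear in y as in physics; the form [inner] of the library is linear
   in its first argument. *)
Definition braket x y : R[i] := inner y x.

(* |x><y| *)
Definition ketbra x y : H -> H := fun z => braket y z *: x.

Definition span S : set H := [set v | exists n (c : 'I_n -> R[i]) (u : 'I_n -> H),
  (forall i, S (u i)) /\ v = \sum_(i < n) c i *: u i].

Definition closed_span S : set H := closure (span S).

Definition closed_subspace S :=
  [/\ S 0, forall (a : R[i]) x y, S x -> S y -> S (a *: x + y) & closed S].

(* The orthogonal projector onto S: for S a closed subspace, proj S x is the
   unique p in S such that x - p is orthogonal to S. *)
Definition proj S : H -> H := fun x =>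
  get [set p | S p /\ forall y, S y -> braket y (x - p) = 0].

Definition orthonormal_basis E :=
  [/\ forall e, E e -> `|e| = 1,
      forall e f, E e -> E f -> e <> f -> braket e f = 0 &
      closed_span E = setT].

Definition bounded_op T := linear T /\ continuous T.

(* The adjoint: by the Riesz representation theorem a bounded T has exactly one
   B as below. *)
Definition adj T : H -> H :=
  get [set B : H -> H | forall x y, braket (T x) y = braket x (B y)].

Definition unitary_op T :=
  [/\ bounded_op T, T \o adj T = id & adj T \o T = id].

(* In R[i], 0 <= z means that z is real and nonnegative. *)
Definition positive_op T := forall x, 0 <= braket x (T x).

(* Tr T = t: the unordered sum of the <e|T e> over any orthonormal basis
   converges to t (R[i]^o is R[i] with its norm topology). *)
Definition has_trace T (t : R[i]) := forall E, orthonormal_basis E ->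
  partial_sum (fun e : E => braket (val e) (T (val e)) : R[i]^o) @ totally
    --> (t : R[i]^o).

(* A = |T| = sqrt (T^* T) *)
Definition is_abs T A :=
  [/\ bounded_op A, positive_op A & A \o A = adj T \o T].

Definition trace_class T :=
  bounded_op T /\ exists A, is_abs T A /\ exists t, has_trace A t.

Definition density_op T := [/\ trace_class T, positive_op T & has_trace T 1].

(* A linear map on the trace class is represented by a map
    on all functions H -> H whose values outside the trace class are
    irrelevant. *)
Implicit Type C : (H -> H) -> (H -> H).

Definition trace_class_linear C :=
  (forall T, trace_class T -> trace_class (C T)) /\
  (forall (a : R[i]) T T', trace_class T -> trace_class T' ->
    C (a *: T + T') = a *: C T + C T').

Definition trace_preserving C := forall T t,
  trace_class T -> has_trace T t -> has_trace (C T) t.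

(* Positivity of the operator on H^n with blocks T i j. *)
Definition positive_block n (T : 'I_n -> 'I_n -> H -> H) :=
  forall x : 'I_n -> H, 0 <= \sum_(i < n) \sum_(j < n) braket (x i) (T i j (x j)).

(* Complete positivity: id (x) C is positive on n x n matrices over the trace
   class, for all n. *)
Definition completely_positive C := forall n (T : 'I_n -> 'I_n -> H -> H),
  (forall i j, trace_class (T i j)) -> positive_block T ->
  positive_block (fun i j => C (T i j)).

(* D is the dual map of C on the bounded operators: Tr (C(T) A) = Tr (T D(A)). *)
Definition is_dual C (D : (H -> H) -> (H -> H)) :=
  (forall A, bounded_op A -> bounded_op (D A)) /\
  (forall T A t, trace_class T -> bounded_op A ->
    has_trace (C T \o A) t -> has_trace (T \o D A) t).

(* Continuity on the bounded operators for the weak-* topology, i.e. the one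
   given by the seminorms A |-> |Tr (T A)| for T in the trace class. *)
Definition weak_star_continuous (D : (H -> H) -> (H -> H)) :=
  forall A0, bounded_op A0 -> forall T, trace_class T ->
  forall eps : R[i], 0 < eps ->
  exists n (F : 'I_n -> H -> H) (delta : R[i]),
    [/\ 0 < delta, forall i, trace_class (F i) &
      forall A, bounded_op A ->
        (forall i t, has_trace (F i \o (A - A0)) t -> `|t| < delta) ->
        forall t, has_trace (T \o (D A - D A0)) t -> `|t| < eps].

Definition normal_map C := exists D, is_dual C D /\ weak_star_continuous D.

Definition quantum_channel C :=
  [/\ trace_class_linear C, completely_positive C, trace_preserving C &
      normal_map C].

Definition decoherence_free C S :=
  closed_subspace S /\
  forall rho, density_op rho -> proj S \o rho \o proj S = rho -> C rho = rho.

Section Representation.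
Context {G : groupType}.
Implicit Type U : G -> H -> H.

Definition unitary_projective_rep U :=
  (forall g, unitary_op (U g)) /\
  (forall g h, exists omega : R[i],
    `|omega| = 1 /\ U g \o U h = omega *: U (g * h)%g).

Definition covariant U C := forall g T, trace_class T ->
  C (U g \o T \o adj (U g)) = U g \o C T \o adj (U g).

Definition confusable U (phi : H) : rel G :=
  fun g h => braket (U g phi) (U h phi) != 0.

End Representation.
End HilbertSpace.

(* Vertex sets of connected components of the graph with edge relation e. *)
Definition graph_component (V : eqType) (e : rel V) (K : set V) :=
  exists v, K = [set w | exists p, path e v p /\ last v p = w].

(* Main.v *)
(* Complete positivity, applied to blocks of the operators |u><v| with u and v
   among the pure fixed points U_g phi, shows that C multiplies |u><v| by a
   scalar l(u,v), the matrix l being positive semidefinite with unit diagonal.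
   Trace preservation forces l(u,v) = 1 when <u|v> <> 0, and positivity of 3x3
   blocks makes l(u,v) = 1 a transitive relation, so C fixes every |u><v| with u
   and v in the span of one component.  Dually, <v|D(A)u> = <v|Au> for the dual
   map D and u, v in the closed span S.  For a state rho = P rho P this gives
   Tr(C(rho) A) = Tr(rho D(A)) = Tr(rho A), the traces being compared term by
   term in an orthonormal basis adapted to S and its orthogonal complement. *)

From mathcomp Require Import all_boot all_order all_algebra.
From mathcomp Require Import finmap sesquilinear complex ring lra.
From mathcomp Require Import all_classical all_reals all_analysis.
From mathcomp.analysis.showcase Require Import summability.
Require Import Defs.

Set Implicit Arguments.
Unset Strict Implicit.
Unset Printing Implicit Defensive.

Import Order.TTheory GRing.Theory Num.Theory.
Import numFieldNormedType.Exports.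

Local Open Scope classical_set_scope.
Local Open Scope ring_scope.

(** * Inner product *)

Section InnerProduct.
Context {R : realType} {H : hilbertType R}.
Implicit Types (x y z u v : H) (a : R[i]).

Lemma braketDr x y z : braket x (y + z) = braket x y + braket x z.
Proof. exact: linearDl. Qed.

Lemma braketZr a x y : braket x (a *: y) = a * braket x y.
Proof. by rewrite /braket linearZl_LR. Qed.

Lemma braketC x y : braket x y = Num.conj (braket y x).
Proof. by rewrite /braket hermC expr0 mul1r. Qed.

Lemma braketDl x y z : braket (x + y) z = braket x z + braket y z.
Proof. exact: linearDr. Qed.

Lemma braketZl a x y : braket (a *: x) y = Num.conj a * braket x y.
Proof. by rewrite /braket linearZr_LR. Qed.

Lemma braket0r x : braket x 0 = 0.
Proof. exact: linear0l. Qed.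

Lemma braket0l x : braket 0 x = 0.
Proof. exact: linear0r. Qed.

Lemma braketBr x y z : braket x (y - z) = braket x y - braket x z.
Proof. exact: linearBl. Qed.

Lemma braketBl x y z : braket (x - y) z = braket x z - braket y z.
Proof. exact: linearBr. Qed.

Lemma braket_sumr (I : Type) (r : seq I) (P : pred I) (F : I -> H) x :
  braket x (\sum_(i <- r | P i) F i) = \sum_(i <- r | P i) braket x (F i).
Proof. exact: linear_sumlz. Qed.

Lemma braket_suml (I : Type) (r : seq I) (P : pred I) (F : I -> H) x :
  braket (\sum_(i <- r | P i) F i) x = \sum_(i <- r | P i) braket (F i) x.
Proof. exact: linear_sumr. Qed.

Lemma braketxx x : braket x x = `|x| ^+ 2.
Proof. by rewrite inner_norm. Qed.

Lemma braket_eq0 x : (braket x x == 0) = (x == 0).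
Proof. by rewrite braketxx expf_eq0 /= normr_eq0. Qed.

Lemma braket_eqP x y : (forall z, braket z x = braket z y) -> x = y.
Proof.
move=> xy; apply/eqP; rewrite -subr_eq0 -braket_eq0 braketBr xy subrr //.
Qed.

Lemma braket_orthoC x y : braket x y = 0 -> braket y x = 0.
Proof. by move=> xy; rewrite braketC xy rmorph0. Qed.

Lemma norm_pythagoras x y : braket x y = 0 ->
  `|x + y| ^+ 2 = `|x| ^+ 2 + `|y| ^+ 2.
Proof.
move=> xy; rewrite -!braketxx braketDl !braketDr xy (braket_orthoC xy).
by rewrite addr0 add0r.
Qed.

Lemma parallelogram x y :
  `|x + y| ^+ 2 + `|x - y| ^+ 2 = 2 * `|x| ^+ 2 + 2 * `|y| ^+ 2.
Proof.
by rewrite -!braketxx !(braketBl, braketBr) !(braketDl, braketDr); ring.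
Qed.

(** Split [y] into its projection [c *: x] on the line of [x] and an orthogonal remainder;
    Pythagoras bounds the norm of the projection by that of [y]. *)
Lemma cauchy_schwarz x y : `|braket x y| <= `|x| * `|y|.
Proof.
have [->|y0] := eqVneq x 0; first by rewrite braket0l !normr0 mul0r.
rewrite -(@ler_pXn2r _ 2) ?nnegrE ?mulr_ge0 //.
have x2 : `|x| ^+ 2 != 0 by rewrite expf_eq0 /= normr_eq0.
pose c := braket x y / `|x| ^+ 2.
have xyc : braket (c *: x) (y - c *: x) = 0.
  by rewrite braketZl braketBr braketZr braketxx divfK // subrr mulr0.
rewrite exprMn; have := norm_pythagoras xyc.
rewrite [c *: x + _]addrC subrK => ->.
rewrite mulrDr normrZ normrM normfV normrX normr_id.
rewrite -[leLHS]addr0 lerD //.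
rewrite le_eqVlt; apply/orP; left; apply/eqP; field.
by rewrite normr_eq0.
Qed.

End InnerProduct.

(** * Orthogonal projection *)

Section Projection.
Context {R : realType} {H : hilbertType R}.
Implicit Types (x y z u v : H) (a : R[i]) (S : set H).

Lemma closure_normP (A : set H) x : closure A x <->
  forall e : R[i], 0 < e -> exists2 s, A s & `|x - s| < e.
Proof.
split=> [+ e e0|Ax B /nbhs_normP[e /= e0 eB]].
  move=> /(_ (ball x e) (nbhsx_ballx _ _ e0))[s [As]].
  by rewrite -ball_normE; exists s.
by have [s As xs] := Ax e e0; exists s; split => //; exact: eB.
Qed.

(* Points of S at distance close to the infimum are close to one another by
   the parallelogram law, so they form a Cauchy filter base. *)
Lemma nearest_point S x : closed_subspace S ->
  exists2 p, S p & forall s, S s -> `|x - p| <= `|x - s|.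
Proof.
case=> S0 Slin Scl.
(* Norms take values in [R[i]], which is only partially ordered; [n] brings them to [R], where
   infima exist and [nra] applies. *)
pose n (y : H) : R := complex.Re `|y|.
have nE (y : H) : `|y| = (n y)%:C%C by rewrite RRe_real// ger0_real.
have n_ge0 y : 0 <= n y by rewrite -ler0c -nE.
have n_tri y z : n (y + z) <= n y + n z.
  by rewrite -lecR rmorphD /= -!nE ler_normD.
have n_par y z : n (y + z) ^+ 2 + n (y - z) ^+ 2 = 2 * n y ^+ 2 + 2 * n z ^+ 2.
  apply: complexI; have := parallelogram y z.
  by rewrite !nE !(rmorphD, rmorphM, rmorphXn, rmorph_nat).
pose D := [set n (x - s) | s in S].
have D_inf : has_inf D.
  by split; [exists (n (x - 0)), 0 | exists 0 => _ [s _ <-]].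
pose d := inf D.
have d_le s : S s -> d <= n (x - s).
  by move=> Ss; apply: ge_inf; [exact: D_inf.2 | exists s].
have d_ge0 : 0 <= d.
  by apply: lb_le_inf; [exact: D_inf.1 | move=> _ [s _ <-]].
pose A (e : R) := [set s | S s /\ n (x - s) < d + e].
have A_ne e : 0 < e -> A e !=set0.
  by move=> /inf_adherent/(_ D_inf)[_ [s Ss <-] sd]; exists s.
(* The midpoint of [s] and [t] lies in [S], hence at distance at least [d] from [x]; the
   parallelogram law then bounds the left side by 4 (d + e)^2 - 4 d^2. *)
have A_diam e s t : A e s -> A e t -> n (s - t) ^+ 2 <= 8 * d * e + 4 * e ^+ 2.
  move=> [Ss sd] [St td].
  have Sm : S (2^-1 *: s + 2^-1 *: t).
    by apply: (Slin) => //; rewrite -[_ *: t]addr0; exact: Slin.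
  have := n_par (x - t) (x - s).
  have -> : x - t - (x - s) = s - t by rewrite opprB addrC addrA subrK.
  have -> : x - t + (x - s) = 2 *: (x - (2^-1 *: s + 2^-1 *: t)).
    rewrite scalerBr scalerDr !scalerA divff // !scale1r scaler_nat mulr2n.
    by rewrite addrACA -opprD [t + s]addrC.
  have -> y : n (2 *: y) = 2 * n y.
    by apply: complexI; rewrite rmorphM /= -!nE rmorph_nat normrZ normr_nat.
  have := d_le _ Sm; have := d_le _ Ss; have := d_le _ St; nra.
pose F := filter_from [set e : R | 0 < e] A.
have FF : ProperFilter F.
  apply: filter_from_proper => //; apply: filter_from_filter.
    by exists 1 => /=.
  move=> e f /= e0 f0; exists (Num.min e f); first by rewrite /= lt_min e0.
  by move=> s [Ss]; rewrite -ltrBlDl lt_min !ltrBlDl => /andP[? ?].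
have /cauchy_cvg Fcvg : cauchy F.
  apply: cauchy_exP => e e0.
  have eE : e = (complex.Re e)%:C%C by rewrite RRe_real// gtr0_real.
  set r := complex.Re e in eE; have r0 : 0 < r by rewrite -ltcR -eE.
  (* As f <= 1, the diameter bound 8 d f + 4 f^2 is at most f (8 d + 4); the constant 5 makes it
     strictly less than r^2. *)
  pose f := Num.min 1 (r ^+ 2 / (8 * d + 5)).
  have d5 : 0 < 8 * d + 5 by lra.
  have f0 : 0 < f by rewrite lt_min ltr01 divr_gt0 // exprn_gt0.
  have f1 : f <= 1 by rewrite ge_min lexx.
  have fr : f * (8 * d + 5) <= r ^+ 2.
    by rewrite -ler_pdivlMr // ge_min lexx orbT.
  have [y Ay] := A_ne f f0; exists y, f => // z Az.
  rewrite -ball_normE /= nE eE ltcR -(@ltr_pXn2r _ 2) ?nnegrE ?n_ge0 ?ltW //.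
  have := A_diam _ _ _ Ay Az; nra.
pose p := lim F; exists p.
  by apply: (@closed_cvg _ _ F _ id S Scl _ p Fcvg); exists 1 => //= s [].

move=> s Ss; rewrite !nE lecR (le_trans _ (d_le _ Ss)) //.
(* Some [t] in [A (e / 2)] lies within [e / 2] of the limit [p], so [p] is at distance less than d +
   e from [x]. *)
apply/ler_addgt0Pr => e e0.
have e20 : 0 < e / 2 by rewrite divr_gt0.
have Fp : F (ball p (e / 2)%:C%C).
  by apply: Fcvg; apply: nbhsx_ballx; rewrite ltcR.
have FA : F (A (e / 2)) by exists (e / 2).
have [t [pt [_ xt]]] := filter_ex (filterI Fp FA).
move: pt; rewrite -ball_normE /= distrC nE ltcR => pt.
have := n_tri (x - t) (t - p); rewrite addrA subrK; lra.
Qed.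

(** The nearest point works: if [x - p] had a nonzero component [c *: y] along some [y] in [S], then
    [c *: y + p] would be closer to [x]. *)
Lemma proj_exists S x : closed_subspace S ->
  exists p, S p /\ forall y, S y -> braket y (x - p) = 0.
Proof.
move=> cS; have [p Sp p_min] := nearest_point x cS; exists p; split => // y Sy.
have [->|y0] := eqVneq y 0; first by rewrite braket0l.
have y2 : `|y| ^+ 2 != 0 by rewrite expf_eq0 /= normr_eq0.
pose c := braket y (x - p) / `|y| ^+ 2.
have yc : braket (c *: y) (x - p - c *: y) = 0.
  by rewrite braketZl braketBr braketZr braketxx divfK // subrr mulr0.
have Sc : S (c *: y + p) by have [_ + _] := cS; exact.
have := norm_pythagoras yc; rewrite [c *: y + _]addrC subrK => xp.
have : `|x - p| ^+ 2 <= `|x - p - c *: y| ^+ 2.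
  by rewrite ler_pXn2r ?nnegrE // -addrA -opprD [p + _]addrC p_min.
rewrite xp gerDr => cy.
have : `|c *: y| ^+ 2 == 0 by rewrite eq_le cy exprn_ge0.
rewrite expf_eq0 /= normr_eq0 scaler_eq0 (negPf y0).
by rewrite orbF mulf_eq0 invr_eq0 (negPf y2) orbF => /eqP.
Qed.

Lemma projP S x : closed_subspace S ->
  S (proj S x) /\ forall y, S y -> braket y (x - proj S x) = 0.
Proof. by move=> cS; exact: (getPex (proj_exists x cS)). Qed.

Lemma proj_unique S x p : closed_subspace S ->
  S p -> (forall y, S y -> braket y (x - p) = 0) -> proj S x = p.
Proof.
move=> cS Sp px; have [Sq qx] := projP x cS.
have Sqp : S (proj S x - p).
  by rewrite addrC -scaleN1r; have [_ + _] := cS; exact.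
apply/eqP; rewrite -subr_eq0 -braket_eq0.
have qp : proj S x - p = (x - p) - (x - proj S x).
  by rewrite opprB [RHS]addrC addrA subrK.
by rewrite {2}qp braketBr qx // px // subrr.
Qed.

(** This lets a vector under the projector be replaced when only its inner products with [S] are
    known. *)
Lemma proj_congr S x y : closed_subspace S ->
  (forall z, S z -> braket z x = braket z y) -> proj S x = proj S y.
Proof.
move=> cS xy; have [Sy yP] := projP y cS; apply: proj_unique => // z Sz.
by rewrite braketBr xy // -braketBr yP.
Qed.

End Projection.

(** * Spans and adjoints *)

Section Spans.
Context {R : realType} {H : hilbertType R}.
Implicit Types (x y z u v : H) (a : R[i]) (S E : set H) (T A B : H -> H).

Lemma span_ind S (P : H -> Prop) : P 0 ->
  (forall a x y, S x -> P y -> P (a *: x + y)) -> forall v, span S v -> P v.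
Proof.
move=> P0 Plin v [n [c [u [Su ->]]]].
elim: n c u Su => [|n IH] c u Su; first by rewrite big_ord0.
rewrite big_ord_recl; apply: Plin => //.
by apply: (IH (c \o lift ord0) (u \o lift ord0)) => i; exact: Su.
Qed.

Lemma span0 S : span S 0.
Proof.
exists 0%N, (fun=> 0), (fun=> 0); split; first by case.
by rewrite big_ord0.
Qed.

Lemma span_cons S a x y : S x -> span S y -> span S (a *: x + y).
Proof.
move=> Sx [n [c [u [Su ->]]]].
exists n.+1, (oapp c a \o unlift ord0), (oapp u x \o unlift ord0); split.
  by move=> i /=; case: (unlift ord0 i) => //= j.
rewrite big_ord_recl /= unlift_none /=; congr (_ + _).
by apply: eq_bigr => i _; rewrite liftK.
Qed.

Lemma subset_span S x : S x -> span S x.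
Proof.
by move=> Sx; rewrite -[x]addr0 -[x]scale1r; exact/span_cons/span0.
Qed.

Lemma span_lin S a x y : span S x -> span S y -> span S (a *: x + y).
Proof.
move=> Sx Sy; elim/span_ind: x / Sx => [|b x z Sx Sz].
  by rewrite scaler0 add0r.
by rewrite scalerDr scalerA -addrA; exact: span_cons.
Qed.

Lemma closed_span_subspace S : closed_subspace (closed_span S).
Proof.
split; [exact/subset_closure/span0| |exact: closed_closure].
move=> a x y /closure_normP Sx /closure_normP Sy; apply/closure_normP => e e0.
(* The added 1 keeps the divisor positive when [a] is zero. *)
have a1 : 0 < `|a| + 1 by rewrite ltr_wpDl.
have [s Ss xs] := Sx (e / 2 / (`|a| + 1)) ltac:(by rewrite !divr_gt0).
have [t St yt] := Sy (e / 2) ltac:(by rewrite divr_gt0).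
exists (a *: s + t); first exact: span_lin.
rewrite opprD addrACA -scalerBr [ltRHS](splitr e).
rewrite (le_lt_trans (ler_normD _ _)) // ler_ltD // normrZ.
rewrite (le_trans _ (y := (`|a| + 1) * `|x - s|)) ?ler_wpM2r ?lerDl //.
by rewrite mulrC -ler_pdivlMr // ltW.
Qed.

Lemma sub_closed_span S : S `<=` closed_span S.
Proof. by move=> x Sx; exact/subset_closure/subset_span. Qed.

Lemma closed_span_min S V :
  closed_subspace V -> S `<=` V -> closed_span S `<=` V.
Proof.
move=> [V0 Vlin Vcl] SV; rewrite [V](closure_id V).1 //; apply: closureS => v.
by elim/span_ind => // a x y Sx Vy; apply: Vlin => //; exact: SV.
Qed.

Lemma lipschitz_continuous (V : normedModType R[i]) (f : H -> V) (k : R[i]) :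
  0 <= k -> (forall x y, `|f x - f y| <= k * `|x - y|) -> continuous f.
Proof.
move=> k0 fk x; apply/(@cvgrPdist_lt _ _ _ (nbhs x)) => e e0.
have k1 : 0 < k + 1 by rewrite ltr_wpDl.
have := @nbhsx_ballx _ _ x (e / (k + 1)) ltac:(by rewrite divr_gt0).
apply: filterS => y; rewrite -ball_normE /= => xy.
rewrite (le_lt_trans (fk x y)) // (le_lt_trans (y := (k + 1) * `|x - y|)) //.
  by rewrite ler_wpM2r // lerDl.
by rewrite mulrC -ltr_pdivlMr.
Qed.

Lemma braket_continuous y : continuous (braket y : H -> R[i]^o).
Proof.
apply: (lipschitz_continuous (normr_ge0 y)) => x z.
by rewrite -[_ - _]braketBr; exact: cauchy_schwarz.
Qed.

Lemma closed_subspace_ker (f : H -> R[i]^o) : continuous f ->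
  (forall a x y, f (a *: x + y) = a * f x + f y) ->
  closed_subspace [set x | f x = 0].
Proof.
move=> fc flin; split => [|a x y /= fx fy|].
- have := flin 1 0 0; rewrite scaler0 addr0 mul1r => /esym/eqP.
  by rewrite -subr_eq0 addrK => /eqP.
- by rewrite flin fx fy mulr0 addr0.
- apply: (@preimage_closed _ _ f [set 0]); first by move=> x _; exact: fc.
  exact/accessible_closed_set1/hausdorff_accessible/norm_hausdorff.
Qed.

Lemma closed_subspace_ortho y : closed_subspace [set x | braket y x = 0].
Proof.
apply: closed_subspace_ker; first exact: braket_continuous.
by move=> a x z; rewrite braketDr braketZr.
Qed.

(** For nonzero [f], take [q] nonzero and orthogonal to the kernel. Each [x] differs from a multiple
    of [q] by an element of the kernel, so [f] is the inner product with a multiple of [q]. *)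
Lemma riesz (f : H -> R[i]^o) : continuous f ->
  (forall a x y, f (a *: x + y) = a * f x + f y) ->
  exists z, forall x, f x = braket z x.
Proof.
move=> fc flin; have cK := closed_subspace_ker fc flin.
have [f0|/existsNP[x0 /eqP fx0]] := pselect (forall x, f x = 0).
  by exists 0 => x; rewrite braket0l f0.
have [/= Kp pK] := projP x0 cK; set q := x0 - _ in pK.
have fq : f q != 0.
  have := flin 1 q (proj [set x | f x = 0] x0).
  by rewrite scale1r subrK mul1r Kp addr0 => <-.
have q2 : `|q| ^+ 2 != 0.
  rewrite -braketxx braket_eq0; apply: contraNneq fq => ->.
  by have [-> _ _] := cK.
exists (Num.conj (f q / `|q| ^+ 2) *: q) => x.
have : braket q (- (f x / f q) *: q + x) = 0.
  apply: braket_orthoC; apply: pK.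
  by rewrite flin mulNr divfK // addNr.
rewrite braketZl conjCK braketDr braketZr braketxx mulNr addrC => /eqP.
rewrite subr_eq0 => /eqP ->; field.
by move: q2; rewrite fq expf_eq0.
Qed.

(** Riesz representation, applied for each [y], shows that the [get] defining [adj] picks a genuine
    adjoint. *)
Lemma adjP T : bounded_op T -> forall x y, braket (T x) y = braket x (adj T y).
Proof.
move=> [Tlin Tc].
have /choice[B TB] : forall y, exists z, forall x, braket y (T x) = braket z x.
  move=> y; apply: (@riesz (fun x => braket y (T x))).
    by move=> x; apply: (continuous_comp (Tc x)); exact: braket_continuous.
  by move=> a u v; rewrite Tlin braketDr braketZr.
pose P (B : H -> H) := forall x y, braket (T x) y = braket x (B y).
apply: (@getPex _ (P : set (H -> H))).
by exists B => x y; rewrite braketC TB -braketC.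
Qed.

Lemma braket_adj T x y : bounded_op T -> braket x (T y) = braket (adj T x) y.
Proof. by move=> bT; rewrite braketC adjP // -braketC. Qed.

Lemma adj_unique T B :
  (forall x y, braket (T x) y = braket x (B y)) -> adj T = B.
Proof.
move=> TB; apply: funext => y; apply: braket_eqP => x; rewrite -TB.
pose P (B' : H -> H) := forall x y, braket (T x) y = braket x (B' y).
have : P (adj T) by apply: (@getPex _ (P : set (H -> H))); exists B.
by move=> ->.
Qed.

Lemma linear_scale T : linear T -> forall a x, T (a *: x) = a *: T x.
Proof.
move=> Tlin a x; have := Tlin 1 0 0; rewrite scaler0 addr0 scale1r => /esym/eqP.
by rewrite -subr_eq0 addrK => /eqP T0; have := Tlin a x 0; rewrite T0 !addr0.
Qed.

Lemma ketbra_adjoint x y u v :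
  braket (ketbra x y u) v = braket u (ketbra y x v).
Proof. by rewrite braketZl braketZr -braketC mulrC. Qed.

Lemma adj_ketbra x y : adj (ketbra x y) = ketbra y x.
Proof. exact/adj_unique/ketbra_adjoint. Qed.

Lemma bounded_ketbra x y : bounded_op (ketbra x y).
Proof.
split.
  by move=> a u v; rewrite /ketbra braketDr braketZr scalerDl scalerA.
apply: (@lipschitz_continuous _ _ (`|x| * `|y|)); first by rewrite mulr_ge0.
move=> u v; rewrite /ketbra -scalerBl -braketBr normrZ mulrC -mulrA.
by rewrite ler_wpM2l // cauchy_schwarz.
Qed.

Lemma ketbra_comp x y T : bounded_op T -> ketbra x y \o T = ketbra x (adj T y).
Proof.
move=> bT; apply: funext => z; rewrite /ketbra /=; congr (_ *: _).
exact: braket_adj.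
Qed.

Lemma comp_ketbra x y T : bounded_op T -> T \o ketbra x y = ketbra (T x) y.
Proof.
by move=> [Tlin _]; apply: funext => z; exact: linear_scale.
Qed.

End Spans.

(** * Orthonormal bases and the trace *)

Section Trace.
Context {R : realType} {H : hilbertType R}.
Implicit Types (x y z u v : H) (a t : R[i]) (S E : set H) (T A B : H -> H).

(** Zorn's lemma is applied to orthonormal families whose members each lie in [S] or in its
    orthogonal complement. *)
Lemma adapted_basis S : closed_subspace S -> exists E, orthonormal_basis E /\
  forall e, E e -> S e \/ forall y, S y -> braket y e = 0.
Proof.
move=> cS.
pose P E := [/\ forall e, E e -> `|e| = 1,
  forall e f, E e -> E f -> e <> f -> braket e f = 0 &
  forall e, E e -> S e \/ forall y, S y -> braket y e = 0].
have [|E [[E1 Eo ES] Emax]] := @Zorn_bigcup _ P.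
  move=> F FP Ftot; split.
  - by move=> e [X FX Xe]; have [+ _ _] := FP X FX; exact.
  - move=> e f [X FX Xe] [Y FY Yf].
    have [XY|YX] := Ftot X Y FX FY.
      by have [_ + _] := FP Y FY; apply => //; exact: XY.
    by have [_ + _] := FP X FX; apply => //; exact: YX.
  - by move=> e [X FX Xe]; have [_ _ +] := FP X FX; exact.
(* A nonzero such [w], once normalised, could be added to [E], against maximality. *)
have E_max w : (forall e, E e -> braket e w = 0) ->
    S w \/ (forall y, S y -> braket y w = 0) -> w = 0.
  move=> Ew Sw; apply: contrapT => /eqP w0.
  pose b := `|w|^-1 *: w.
  have b1 : `|b| = 1.
    by rewrite normrZ normfV normr_id mulVf // normr_eq0.
  have Eb e : E e -> braket e b = 0.
    by move=> /Ew; rewrite braketZr => ->; rewrite mulr0.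
  apply: (Emax (E `|` [set b])).
    split; first by move=> e Ee; left.
    move=> /(_ b (or_intror erefl)) /Eb /eqP.
    by rewrite braketxx b1 expr1n oner_eq0.
  split.
  - by move=> e [/E1//|->].
  - move=> e f [Ee|->] [Ef|->] //; first exact: Eo.
      by move=> _; exact: Eb.
    by move=> _; apply: braket_orthoC; exact: Eb.
  - move=> e [/ES//|->]; case: Sw => Sw; [left|right].
      have [S0 Slin _] := cS.
      by have := Slin `|w|^-1 w 0 Sw S0; rewrite addr0.
    by move=> y /Sw; rewrite braketZr => ->; rewrite mulr0.
exists E; split => //; split => //; rewrite -subTset => x _.
have [Tx xT] := projP x (closed_span_subspace E).
set q := x - _ in xT.
have Eq e : E e -> braket e q = 0 by move=> /sub_closed_span; exact: xT.
have [Sq qS] := projP q cS.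
(* The residual [q] is orthogonal to [E]. So are its components in [S] and in the complement, since
   each [e] is orthogonal to one of them; maximality then kills both. *)
have Sqe e : E e -> braket e (proj S q) = 0 /\ braket e (q - proj S q) = 0.
  move=> Ee; have := Eq e Ee; rewrite braketBr => eq0.
  have eq1 : braket e (proj S q) = 0.
    case: (ES e Ee) => [/qS|/(_ _ Sq)/braket_orthoC //].
    by rewrite braketBr eq0 sub0r => /eqP; rewrite oppr_eq0 => /eqP.
  by rewrite eq1 eq0 subr0.
have q1 : proj S q = 0 by apply: E_max; [move=> e /Sqe[] | left].
have q2 : q - proj S q = 0 by apply: E_max; [move=> e /Sqe[] | right].
move: q2; rewrite q1 subr0 => /eqP.
by rewrite subr_eq0 => /eqP ->.
Qed.

#[local] Existing Instance totally_filter.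

(** * Fourier partial sums and Parseval's identity *)

Section Parseval.
Variable E : set H.
Hypothesis basisE : orthonormal_basis E.
Implicit Type J : {fset E}.

Let fourier J x := partial_sum (fun e : E => braket (val e) x *: val e) J.

Lemma fourier_lin J a x y :
  fourier J (a *: x + y) = a *: fourier J x + fourier J y.
Proof.
rewrite /fourier /partial_sum scaler_sumr -big_split /=.
by apply: eq_bigr => e _; rewrite braketDr braketZr scalerDl scalerA.
Qed.

Lemma orthonormal_braket (e f : E) : braket (val e) (val f) = (e == f)%:R.
Proof.
have [E1 Eo _] := basisE; have [->|ef] := eqVneq e f.
  by rewrite braketxx E1 ?expr1n //; exact: set_valP.
apply: Eo; [exact: set_valP | exact: set_valP |].
by move/val_inj/eqP; exact/negP.
Qed.

Lemma braket_fourier J (e : E) x :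
  e \in J -> braket (val e) (fourier J x) = braket (val e) x.
Proof.
move=> eJ; rewrite /fourier /partial_sum braket_sumr (bigD1 [` eJ]%fset) //=.
rewrite braketZr orthonormal_braket eqxx mulr1 big1 ?addr0 // => f fe.
rewrite braketZr orthonormal_braket.
case: eqVneq => [ef|]; last by rewrite mulr0.
by case/eqP: fe; apply: val_inj.
Qed.

Lemma fourier_basis J (e : E) : e \in J -> fourier J (val e) = val e.
Proof.
move=> eJ; rewrite /fourier /partial_sum (bigD1 [` eJ]%fset) //=.
rewrite orthonormal_braket eqxx scale1r big1 ?addr0 // => f fe.
rewrite orthonormal_braket; case: eqVneq => [ef|]; last by rewrite scale0r.
by case/eqP: fe; apply: val_inj.
Qed.

(** The Fourier sum is an orthogonal projection, so the remainder is a leg of a right triangle with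
    hypotenuse [x]. *)
Lemma fourier_contraction J x : `|x - fourier J x| <= `|x|.
Proof.
have o : braket (fourier J x) (x - fourier J x) = 0.
  rewrite {1}/fourier /partial_sum braket_suml big1 // => e _.
  by rewrite braketZl braketBr (braket_fourier _ (fsvalP e)) subrr mulr0.
rewrite -(@ler_pXn2r _ 2) ?nnegrE //.
have := norm_pythagoras o; rewrite [fourier J x + _]addrC subrK => ->.
by rewrite lerDr exprn_ge0.
Qed.

(** Equality holds as soon as the finite set [J] contains the basis vectors occurring in [s]. *)
Lemma fourier_span s : span E s -> \forall J \near totally, fourier J s = s.
Proof.
move: s; apply: span_ind => [|a e s Ee IH].
  apply: nearW => J; rewrite /fourier /partial_sum big1 // => e _.
  by rewrite braket0r scale0r.
pose eE : E := SigSub (mem_set Ee).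
near=> J; rewrite fourier_lin; congr (_ *: _ + _); last by near: J.
apply: (@fourier_basis J eE); near: J.
by exists [fset eE]%fset => // J /= /fsubsetP; apply; rewrite inE.
Unshelve. all: by end_near. Qed.

(** Approximate [y] by [s] in the span. Once [J] reproduces [s], the error of [y] equals that of
    [y - s], which the contraction bound and Cauchy-Schwarz control. *)
Lemma parseval x y :
  partial_sum (fun e : E => braket y (val e) * braket (val e) x : R[i]^o)
    @ totally --> (braket y x : R[i]^o).
Proof.
apply/cvgrPdist_lt => eps eps0.
have x1 : 0 < `|x| + 1 by rewrite ltr_wpDl.
have : closed_span E y by have [_ _ ->] := basisE.
move=> /closure_normP/(_ (eps / (`|x| + 1)))[|s /fourier_span Es ys].
  by rewrite divr_gt0.
near=> J; have Js : fourier J s = s by near: J.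
have -> : partial_sum
    (fun e : E => braket y (val e) * braket (val e) x : R[i]^o) J =
    braket (fourier J y) x.
  rewrite /fourier /partial_sum braket_suml; apply: eq_bigr => e _.
  by rewrite braketZl -braketC.
rewrite -[_ - _]braketBl (le_lt_trans (cauchy_schwarz _ _)) //.
have -> : y - fourier J y = y - s - fourier J (y - s).
  have -> : fourier J (y - s) = fourier J y - s.
    by rewrite addrC -scaleN1r fourier_lin Js scaleN1r addrC.
  by rewrite opprB addrA subrK.
apply: (@le_lt_trans _ _ (`|y - s| * (`|x| + 1))); last by rewrite -ltr_pdivlMr.
by rewrite ler_pM ?fourier_contraction // lerDl.
Unshelve. all: by end_near. Qed.

End Parseval.

Lemma has_trace_ketbra x y : has_trace (ketbra x y) (braket y x).
Proof.
move=> E bE; rewrite (_ : (fun e : E => _) =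
  fun e : E => braket y (val e) * braket (val e) x); first exact: parseval.
by apply: funext => e; rewrite braketZr.
Qed.

(** Since [has_trace] speaks of every basis, comparing diagonal entries in one convenient basis is
    enough. *)
Lemma trace_eq E T t T' t' : orthonormal_basis E ->
  (forall e, E e -> braket e (T e) = braket e (T' e)) ->
  has_trace T t -> has_trace T' t' -> t = t'.
Proof.
move=> bE TT' /(_ E bE) + /(_ E bE).
have -> : (fun e : E => braket (val e) (T (val e)) : R[i]^o) =
    (fun e : E => braket (val e) (T' (val e))).
  by apply: funext => e; apply: TT'; exact: set_valP.
by move=> Tt Tt'; exact: (cvg_unique (@norm_hausdorff _ R[i]^o) Tt Tt').
Qed.

(** Uniqueness requires that some orthonormal basis exist, as [has_trace] would otherwise hold
    vacuously; the trivial subspace provides one. *)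
Lemma trace_unique T t t' : has_trace T t -> has_trace T t' -> t = t'.
Proof.
have [E [bE _]] := adapted_basis (closed_span_subspace (@set0 H)).
exact: (trace_eq bE).
Qed.

Lemma trace_class_ketbra x y : trace_class (ketbra x y).
Proof.
split; first exact: bounded_ketbra.
have xy_ge0 : 0 <= `|x| / `|y| by rewrite divr_ge0.
(* The absolute value of |x><y| is |y><y| scaled by the ratio of the norms. For [y = 0] the quotient
   is 0 by convention and both operators vanish. *)
exists (ketbra ((`|x| / `|y|) *: y) y); split; last first.
  by exists (braket y ((`|x| / `|y|) *: y)); exact: has_trace_ketbra.
split; first exact: bounded_ketbra.
  move=> z; rewrite braketZr braketZr [braket z y]braketC mulrCA -normCK.
  by rewrite mulr_ge0 // exprn_ge0.
have conjN (r : R[i]) : 0 <= r -> Num.conj r = r.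
  by move=> /ger0_real/CrealP.
rewrite comp_ketbra; last exact: bounded_ketbra.
rewrite adj_ketbra comp_ketbra; last exact: bounded_ketbra.
congr ketbra; rewrite /ketbra braketZr !braketxx scalerA.
have [->|y0] := eqVneq y 0; first by rewrite !scaler0.
by congr (_ *: _); field; rewrite normr_eq0.
Qed.

End Trace.

Arguments has_trace_ketbra {R H} x y.

(** * Rank-one operators fixed by a channel *)

Section FixedKetbras.
Context {R : realType} {H : hilbertType R}.
Implicit Types (x y z u v w : H) (a b c : R[i]) (S E V : set H).
Implicit Types (T A B : H -> H).

Lemma ketbra_linl a x y z :
  ketbra (a *: x + y) z = a *: ketbra x z + ketbra y z.
Proof.
by apply: funext => t; rewrite /ketbra scalerDr scalerA mulrC -scalerA.
Qed.

Lemma ketbra_linr a x y z :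
  ketbra z (a *: x + y) = Num.conj a *: ketbra z x + ketbra z y.
Proof.
by apply: funext => t; rewrite /ketbra braketDl braketZl scalerDl -scalerA.
Qed.

(** The double sum factors as the squared modulus of [s]. *)
Lemma positive_block_ketbra n (w : 'I_n -> H) :
  positive_block (fun i j => ketbra (w i) (w j)).
Proof.
move=> x; set s := \sum_(i < n) braket (w i) (x i).
suff -> : \sum_(i < n) \sum_(j < n) braket (x i) (ketbra (w i) (w j) (x j))
    = s * Num.conj s by rewrite -normCK exprn_ge0.
rewrite rmorph_sum mulr_sumr; apply: eq_bigr => i _; rewrite mulr_suml.
by apply: eq_bigr => j _; rewrite braketZr [braket (x i) _]braketC.
Qed.

(** If [s] were nonzero, the choice r = - (k + 1) / s would give the value -1. *)
Lemma real_affine_ge0 (s k : R[i]) : 0 <= k ->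
  (forall r, r \is Num.real -> 0 <= r * s + k) -> s = 0.
Proof.
move=> k0 sk; apply: contrapT => /eqP s0.
have kr : k \is Num.real by exact: ger0_real.
(* The choice r = 1 shows that [s] is real, so that the witness below is real too. *)
have sr : s \is Num.real.
  have sk1 : 0 <= s + k by rewrite -[s]mul1r sk.
  by rewrite -[s](addrK k) rpredB // ger0_real.
have /sk : - (k + 1) / s \is Num.real.
  by rewrite realM ?realV // realN realD ?real1.
by rewrite divfK // opprD addrAC addNr add0r oppr_ge0 ler10.
Qed.

(** Real [c] gives s + t = 0 and purely imaginary [c] gives t - s = 0. This extracts equations on
    off-diagonal entries from block positivity. *)
Lemma hermitian_affine_ge0 (s t k : R[i]) : 0 <= k ->
  (forall c, 0 <= Num.conj c * s + c * t + k) -> s = 0 /\ t = 0.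
Proof.
move=> k0 stk.
have st : s + t = 0.
  apply: (real_affine_ge0 k0) => r /CrealP rr.
  by have := stk r; rewrite rr -mulrDr.
have ts : 'i%R * (t - s) = 0.
  apply: (real_affine_ge0 k0) => r /CrealP rr.
  have := stk (r * 'i%R); rewrite rmorphM /= rr conjCi.
  by congr (0 <= _ + _); ring.
move: ts => /eqP; rewrite mulf_eq0 (negPf (neq0Ci _)) subr_eq0 => /eqP ts.
by move: st => /eqP; rewrite ts -mulr2n mulrn_eq0 /= => /eqP.
Qed.

Variable C : (H -> H) -> (H -> H).
Hypothesis linC : trace_class_linear C.
Hypothesis cpC : completely_positive C.
Hypothesis tpC : trace_preserving C.

Lemma linear_C_ketbra x y : linear (C (ketbra x y)).
Proof.
by have [tc _] := linC; have [[]] := tc _ (trace_class_ketbra x y).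
Qed.

Lemma positive_block_C n (w : 'I_n -> H) :
  positive_block (fun i j => C (ketbra (w i) (w j))).
Proof.
apply: cpC => [i j|]; [exact: trace_class_ketbra|exact: positive_block_ketbra].
Qed.

Lemma positive_block_C2 u v x y : C (ketbra u u) = ketbra u u ->
  C (ketbra v v) = ketbra v v ->
  0 <= braket x (C (ketbra u v) y) + braket y (C (ketbra v u) x) +
       (`|braket u x| ^+ 2 + `|braket v y| ^+ 2).
Proof.
move=> Cu Cv; have := positive_block_C (fun i : 'I_2 => nth 0 [:: u; v] i)
  (fun i : 'I_2 => nth 0 [:: x; y] i).
rewrite !big_ord_recl !big_ord0 /= Cu Cv !braketZr.
rewrite [braket x u]braketC [braket y v]braketC -!normCK.
by congr (0 <= _); ring.
Qed.

(** Positivity of the 2x2 block forces [T] to vanish on the complement of [v] and to take values in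
    the line of [u]. *)
Lemma C_ketbra_scale u v : `|u| = 1 -> `|v| = 1 ->
  C (ketbra u u) = ketbra u u -> C (ketbra v v) = ketbra v v ->
  C (ketbra u v) = braket u (C (ketbra u v) v) *: ketbra u v.
Proof.
move=> u1 v1 Cu Cv; set T := C (ketbra u v).
have Tlin : linear T := linear_C_ketbra u v.
have TZ := linear_scale Tlin.
(* For [y] orthogonal to [v], rescaling [y] by [c] leaves no quadratic term in the block form, so
   its coefficients in [c] vanish. The next claim rescales [x] instead. *)
have vT y : braket v y = 0 -> T y = 0.
  move=> vy; apply: braket_eqP => x; rewrite braket0r.
  have k0 : 0 <= `|braket u x| ^+ 2 by rewrite exprn_ge0.
  have [|_ //] := @hermitian_affine_ge0 (braket y (C (ketbra v u) x))
    (braket x (T y)) _ k0.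
  move=> c; have := positive_block_C2 x (c *: y) Cu Cv.
  rewrite -/T TZ !braketZr braketZl vy mulr0 normr0 expr0n addr0.
  by rewrite [_ * braket y _ + _]addrC.
have uT x y : braket u x = 0 -> braket x (T y) = 0.
  move=> ux; have k0 : 0 <= `|braket v y| ^+ 2 by rewrite exprn_ge0.
  have [|-> //] := @hermitian_affine_ge0 (braket x (T y))
    (braket y (C (ketbra v u) x)) _ k0.
  move=> c; have := positive_block_C2 (c *: x) y Cu Cv.
  rewrite -/T (linear_scale (linear_C_ketbra v u)) !braketZr braketZl ux.
  by rewrite mulr0 normr0 expr0n add0r.
have uu1 : braket u u = 1 by rewrite braketxx u1 expr1n.
have vv1 : braket v v = 1 by rewrite braketxx v1 expr1n.
apply: funext => y; transitivity (braket u (T v) *: (braket v y *: u)) => //.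
have -> : T y = braket v y *: T v.
  apply/eqP; rewrite -subr_eq0 -TZ -scaleN1r addrC -Tlin scaleN1r addrC.
  by rewrite vT // braketBr braketZr vv1 mulr1 subrr.
have {1}-> : T v = braket u (T v) *: u.
  apply: braket_eqP => x; rewrite braketZr.
  have := @uT (x - braket u x *: u) v.
  rewrite braketBr braketZr uu1 mulr1 subrr => /(_ erefl).
  by rewrite braketBl braketZl -braketC mulrC => /eqP; rewrite subr_eq0 => /eqP.
by rewrite !scalerA mulrC.
Qed.

(** The trace of |u><v| is <v|u>; as it is nonzero and preserved, the scalar must be 1. *)
Lemma C_ketbra_nonorthogonal u v : `|u| = 1 -> `|v| = 1 ->
  C (ketbra u u) = ketbra u u -> C (ketbra v v) = ketbra v v ->
  braket u v != 0 -> C (ketbra u v) = ketbra u v.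
Proof.
move=> u1 v1 Cu Cv uv; have := C_ketbra_scale u1 v1 Cu Cv.
set c := braket u _ => Cuv; rewrite Cuv.
have vu : braket v u != 0 by apply: contra_neq uv; exact: braket_orthoC.
have cK : c *: ketbra u v = ketbra (c *: u) v.
  by apply: funext => y; rewrite /ketbra scalerA mulrC -scalerA.
have := tpC (trace_class_ketbra u v) (has_trace_ketbra u v).
rewrite Cuv cK => /trace_unique/(_ (has_trace_ketbra _ _)).
rewrite braketZr -{1}[braket v u]mul1r => /(mulIf vu) <-.
by rewrite scale1r.
Qed.

(** Testing the 3x3 block on suitable multiples of [u], [v], [w] leaves a form in [c] whose
    coefficients are [l - 1] and [m - 1], with no constant term. *)
Lemma C_ketbra_trans u v w : `|u| = 1 -> `|v| = 1 -> `|w| = 1 ->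
  C (ketbra u u) = ketbra u u -> C (ketbra v v) = ketbra v v ->
  C (ketbra w w) = ketbra w w ->
  C (ketbra u v) = ketbra u v -> C (ketbra v u) = ketbra v u ->
  C (ketbra v w) = ketbra v w -> C (ketbra w v) = ketbra w v ->
  C (ketbra u w) = ketbra u w /\ C (ketbra w u) = ketbra w u.
Proof.
move=> u1 v1 w1 Cu Cv Cw Cuv Cvu Cvw Cwv.
have Cuw := C_ketbra_scale u1 w1 Cu Cw; have Cwu := C_ketbra_scale w1 u1 Cw Cu.
set l := braket u _ in Cuw; set m := braket w _ in Cwu.
have uu : braket u u = 1 by rewrite braketxx u1 expr1n.
have vv : braket v v = 1 by rewrite braketxx v1 expr1n.
have ww : braket w w = 1 by rewrite braketxx w1 expr1n.
have [|/eqP l1 /eqP m1] := @hermitian_affine_ge0 (l - 1) (m - 1) 0 (lexx 0).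
  (* the middle coefficient makes the sum of the three coefficients vanish *)
  move=> c; have := positive_block_C (fun i : 'I_3 => nth 0 [:: u; v; w] i)
    (fun i : 'I_3 => nth 0 [:: c *: u; - (c + 1) *: v; w] i).
  rewrite !big_ord_recl !big_ord0 /= Cu Cv Cw Cuv Cvu Cvw Cwv Cuw Cwu.
  rewrite /ketbra !(braketZr, braketZl) uu vv ww rmorphN rmorphD rmorph1.
  by congr (0 <= _); ring.
rewrite Cuw Cwu; move: l1 m1; rewrite !subr_eq0 => /eqP -> /eqP ->.
by rewrite !scale1r.
Qed.

Lemma C_ketbra_span V :
  (forall u v, V u -> V v -> C (ketbra u v) = ketbra u v) ->
  forall u v, span V u -> span V v -> C (ketbra u v) = ketbra u v.
Proof.
move=> CV; have [_ Clin] := linC.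
have tc := @trace_class_ketbra R H.
(* That [C] sends the zero operator to zero comes from linearity with coefficient -1 and both
   operators equal. *)
have C0 x y : ketbra x y = 0 -> C (ketbra x y) = ketbra x y.
  move=> xy; have := Clin (- 1) _ _ (tc x y) (tc x y).
  by rewrite !scaleN1r !addNr xy.
have CVr u v : V u -> span V v -> C (ketbra u v) = ketbra u v.
  move=> Vu; move: v; apply: span_ind => [|a x y Vx Cuy].
    by apply: C0; apply: funext => t; rewrite /ketbra braket0l scale0r.
  by rewrite ketbra_linr Clin // Cuy CV.
move=> u v + Vv; move: u; apply: span_ind => [|a x y Vx Cyv].
  by apply: C0; apply: funext => t; rewrite /ketbra scaler0.
by rewrite ketbra_linl Clin // Cyv CVr.
Qed.

(** The passage from the span to its closure takes place on the dual side, where matrix elements of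
    the bounded operators [A] and [D A] are continuous in each vector. *)
Lemma decoherence_free_closed_span V : normal_map C ->
  (forall u v, V u -> V v -> C (ketbra u v) = ketbra u v) ->
  decoherence_free C (closed_span V).
Proof.
move=> [D [[Dbd Dtr] _]] /C_ketbra_span CV.
have cS := closed_span_subspace V; split => // rho [tcr _ _] rhoE.
(* Both sides are traces: of |u><v| composed with [D A], and of its image under [C], again |u><v|,
   composed with [A]. *)
have D_span A u v : bounded_op A -> span V u -> span V v ->
    braket v (D A u) = braket v (A u).
  move=> bA Vu Vv; have bDA := Dbd _ bA.
  have := Dtr (ketbra u v) A (braket (adj A v) u) (trace_class_ketbra _ _) bA.
  rewrite CV // !ketbra_comp // => /(_ (has_trace_ketbra _ _)).
  move=> /trace_unique/(_ (has_trace_ketbra _ _)) Avu.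
  by rewrite !braket_adj.
have D_S A u v : bounded_op A -> closed_span V u -> closed_span V v ->
    braket v (D A u) = braket v (A u).
  move=> bA; have bDA := Dbd _ bA.
  (* The closure is reached one variable at a time; adjoints turn each equation into orthogonality
     to a fixed vector, which defines a closed subspace. *)
  have D_l v' : span V v' -> closed_span V `<=`
      [set u | braket (adj (D A) v' - adj A v') u = 0].
    move=> Vv; apply: closed_span_min; first exact: closed_subspace_ortho.
    move=> x /subset_span Vx /=; rewrite braketBl -!braket_adj // D_span //.
    by rewrite subrr.
  move=> Su; have : closed_span V `<=` [set v | braket (D A u - A u) v = 0].
    apply: closed_span_min; first exact: closed_subspace_ortho.
    move=> x /subset_span Vx /=; apply: braket_orthoC.
    by rewrite braketBr !braket_adj // -braketBl; exact: D_l.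
  move=> /[apply] /braket_orthoC; rewrite braketBr => /eqP.
  by rewrite subr_eq0 => /eqP.
have brho : bounded_op rho by case: tcr.
have bCrho : bounded_op (C rho) by have [+ _] := linC; case/(_ _ tcr).
(* The entry <y|C(rho)x> is the trace of [C rho] composed with |x><y|, so rank-one test operators
   suffice. *)
apply: funext => x; apply: braket_eqP => y; have bA := bounded_ketbra x y.
have [E [bE ES]] := adapted_basis cS.
apply: (trace_eq bE (T := rho \o D (ketbra x y)) (T' := rho \o ketbra x y)).
(* For [e] in [S], only the projection of [D A e] onto [S] matters. For [e] orthogonal to [S], both
   entries vanish because [rho] has range in [S]. *)
- move=> e Ee /=; case: (ES e Ee) => [Se|eS].
    rewrite -rhoE /=; congr (braket e (proj _ (rho _))).
    by apply: proj_congr => // z Sz; exact: D_S.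
  have rhoS z : closed_span V (rho z) by rewrite -rhoE; exact: (projP _ cS).1.
  by rewrite !(braket_orthoC (eS _ (rhoS _))).
- apply: Dtr => //; rewrite comp_ketbra //; exact: has_trace_ketbra.
- rewrite comp_ketbra //; exact: has_trace_ketbra.
Qed.

End FixedKetbras.

(** * Propagation of fixed operators along paths of the confusability graph *)

Theorem proposition4p1 (R : realType) (G : groupType) (H : hilbertType R)
    (U : G -> H -> H) (C : (H -> H) -> (H -> H)) (phi : H) :
  unitary_projective_rep U ->
  quantum_channel C ->
  covariant U C ->
  `|phi| = 1 ->
  C (ketbra phi phi) = ketbra phi phi ->
  forall Gk : set G, graph_component (confusable U phi) Gk ->
    decoherence_free C (closed_span [set U g phi | g in Gk]).
Proof.
move=> [unitU _] [linC cpC tpC normC] covC phi1 Cphi Gk [k ->].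
have bU g : bounded_op (U g) by have [] := unitU g.
have U1 g : `|U g phi| = 1.
  have [_ _ UU] := unitU g; apply/eqP.
  rewrite -(@eqrXn2 _ 2) ?expr1n // -braketxx adjP // -[adj _ _]/((_ \o _) _).
  by rewrite UU braketxx phi1 expr1n.
(* Covariance transports the fixed point [phi] along its orbit. *)
have CU g : C (ketbra (U g phi) (U g phi)) = ketbra (U g phi) (U g phi).
  have <- : U g \o ketbra phi phi \o adj (U g) = ketbra (U g phi) (U g phi).
    rewrite comp_ketbra //; apply: funext => z; rewrite /ketbra /=.
    by rewrite adjP.
  by rewrite covC ?Cphi //; exact: trace_class_ketbra.
(* Recording both orders makes the relation symmetric, so that paths can be reversed. *)
pose fixed g h := C (ketbra (U g phi) (U h phi)) = ketbra (U g phi) (U h phi) /\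
  C (ketbra (U h phi) (U g phi)) = ketbra (U h phi) (U g phi).
have fixed_trans g h l : fixed g h -> fixed h l -> fixed g l.
  by move=> [gh hg] [hl lh]; apply: (C_ketbra_trans linC cpC (v := U h phi)).
have fixed_edge g h : confusable U phi g h -> fixed g h.
  move=> gh; split; apply: C_ketbra_nonorthogonal => //.
  by apply: contra_neq gh; exact: braket_orthoC.
have fixed_path p g : path (confusable U phi) g p -> fixed g (last g p).
  elim: p g => [|h p IH] g /=; first by [].
  by case/andP=> /fixed_edge gh /IH; exact: fixed_trans.
apply: decoherence_free_closed_span => //.
move=> _ _ [g [p [kp <-]] <-] [h [q [kq <-]] <-].
(* Both vertices are reached from [k]; the first path is reversed and joined to the second. *)
have [gk kg] := fixed_path _ _ kp.
exact: (fixed_trans _ k _ (conj kg gk) (fixed_path _ _ kq)).1.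
Qed.
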